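(* Let $\Omega\subset\mathbb C=\mathbb R^2$ be a bounded simply connected domain with smooth boundary, $\Omega_0\subset\subset\Omega$, $0<\epsilon<1$, and let $\mu\in L^\infty(\Omega)$ be real-valued with $\mathrm{ess\,supp}\,\mu\subset\Omega_0$ and $\|\mu\|_{L^\infty}\le1-\epsilon$. Let $\widehat{\omega^\pm}\sim\sum_{n\ge1}\widehat{\omega_n^\pm}$ be the (formal) Neumann series corresponding to the Beltrami coefficients $\pm\mu$, and let $\widehat{\omega^\pm_{odd}}$, $\widehat{\omega^\pm_{even}}$ denote the parts consisting of the terms with $n$ odd, respectively $n$ even. Then each of $\widehat{\omega^+_{odd}}$ and $\widehat{\omega^+_{even}}$ has the same parity, under $\mu\to-\mu$, as the multilinear degrees of its terms, i.e. (as formal series, term by term) $$\widehat{\omega^+_{odd}}=-\widehat{\omega^-_{odd}}\quad\text{and}\quad\widehat{\omega^+_{even}}=\widehat{\omega^-_{even}} .$$ Equivalently, $$\widehat{\omega^+_{odd}}=\frac{\widehat{\omega^+}-\widehat{\omega^-}}2\quad\text{and}\quad\widehat{\omega^+_{even}}=\frac{\widehat{\omega^+}+\widehat{\omega^-}}2 .$$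
   Context: $\mu$ is extended by $0$ to $\mathbb C$. For $k\in\mathbb C$, $\omega^\pm(\cdot,k)$ is determined by the unique solution $f_{\pm\mu}=e^{ikz}(1+\omega^\pm(z,k))$, $\omega^\pm=O(1/|z|)$ as $|z|\to\infty$, of $\bar\partial_zf_{\pm\mu}=\pm\mu\,\overline{\partial_zf_{\pm\mu}}$ on $\mathbb C$. Notation: $e_k(z)=\exp(2i\,\mathrm{Re}(kz))$; $Pf(z)=-\frac1\pi\int_{\mathbb C}\frac{f(z_1)}{z_1-z}\,d^2z_1$; $Sf(z)=-\frac1\pi\,\mathrm{p.v.}\!\int_{\mathbb C}\frac{f(z_1)}{(z_1-z)^2}\,d^2z_1$; $\nu=e_{-k}\mu$, $\alpha=-i\bar ke_{-k}\mu$; $A^\pm=\mp(\overline\alpha P+\overline\nu S)$; $\rho(f)=\overline f$. The function $u^\pm$ with $\overline{u^\pm}=-\bar\partial\omega^\pm$ solves $(I+A^\pm\rho)u^\pm=\mp\overline\alpha$. The Neumann series terms are $u_1^\pm=\mp\overline\alpha$, $u_{n+1}^\pm=-A^\pm\overline{u_n^\pm}$, $\omega_n^\pm=-P\,\overline{u_n^\pm}$, and $\omega^\pm\sim\sum_{n\ge1}\omega_n^\pm$ as a formal series. The hat is the partial Fourier transform: with $k=\tau e^{i\varphi}$, $\tau\in\mathbb R$, $\widehat{\omega_n^\pm}(z,t,e^{i\varphi})=\int_{\mathbb R}e^{-it\tau}\omega_n^\pm(z,\tau e^{i\varphi})\,d\tau$ in the sense of tempered distributions. *)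

(* Defs.v *)
From HB Require Import structures.
From mathcomp Require Import all_boot all_order all_algebra.
From mathcomp Require Import all_classical all_reals all_analysis.
From mathcomp Require Import complex.

Set Implicit Arguments.
Unset Strict Implicit.
Unset Printing Implicit Defensive.

Import Order.TTheory GRing.Theory Num.Theory.
Import numFieldNormedType.Exports.

Local Open Scope classical_set_scope.
Local Open Scope ring_scope.
Local Open Scope complex_scope.

(* MathComp-Analysis attaches its topology to an abstract numFieldType; this
   makes that same normed-space structure available directly on R[i]. *)
Set Warnings "-redundant-canonical-projection".
HB.instance Definition _ (R : realType) := NormedModule.copy R[i] (R[i]^o).

Section Plane.
Context {R : realType}.
Implicit Types (Omega : set R[i]) (O : set (R * R)).

(* The identification R^2 = C, through which Lebesgue measure and smoothness on
   R^2 are transported to C. *)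
Definition toC (p : R * R) : R[i] := p.1 +i* p.2.

Definition leb2 := (@lebesgue_measure R \x @lebesgue_measure R)%E.

Definition simply_connected Omega : Prop :=
  forall gamma : R -> R[i],
    {within `[0, 1], continuous gamma} -> gamma @` `[0, 1] `<=` Omega ->
    gamma 0 = gamma 1 ->
    exists H : R * R -> R[i],
      [/\ {within `[0, 1] `*` `[0, 1], continuous H},
          H @` (`[0, 1] `*` `[0, 1]) `<=` Omega,
          forall t, t \in `[0, 1] -> H (0, t) = gamma t /\ H (1, t) = gamma 0
        & forall s, s \in `[0, 1] -> H (s, 0) = gamma 0 /\ H (s, 1) = gamma 0].

(* C^oo on R^2: every iterated directional derivative is differentiable. *)
Definition smooth (f : R * R -> R) : Prop :=
  forall (vs : seq (R * R)) (p : R * R),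
    differentiable (foldr (fun v g q => 'D_v g q) f vs) p.

(* O lies locally on one side of its boundary, which is a smooth curve. *)
Definition smooth_boundary O : Prop :=
  forall p, (closure O `\` interior O) p ->
    exists rho : R * R -> R,
      [/\ smooth rho, exists v, 'D_v rho p != 0
        & \forall q \near p, O q <-> rho q < 0].

Definition ess_supp (f : R[i] -> R) : set R[i] :=
  [set z | forall U, nbhs z U ->
     ~ leb2.-negligible (toC @^-1` (U `&` [set w | f w != 0]))].

End Plane.

Section ComplexIntegral.
Context {R : realType}.

Definition cintegral d (T : measurableType d) (m : {measure set T -> \bar R})
    (D : set T) (f : T -> R[i]) : R[i] :=
  (\int[m]_(x in D) complex.Re (f x))%R +i*
  (\int[m]_(x in D) complex.Im (f x))%R.

Definition cintegral2 (D : set R[i]) (f : R[i] -> R[i]) : R[i] :=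
  cintegral leb2 (toC @^-1` D) (f \o toC).

Definition cauchyT (f : R[i] -> R[i]) (z : R[i]) : R[i] :=
  - (pi^-1)%:C * cintegral2 setT (fun z1 => f z1 / (z1 - z)).

Definition beurlingT (f : R[i] -> R[i]) (z : R[i]) : R[i] :=
  - (pi^-1)%:C *
  lim (cintegral2 [set z1 | e%:C < `|z1 - z|] (fun z1 => f z1 / (z1 - z) ^+ 2)
       @[e --> 0^'+]).

Definition expi (t : R) : R[i] := cos t +i* sin t.

End ComplexIntegral.

Variant sign := Plus | Minus.

Section Neumann.
Context {R : realType}.
Implicit Types (mu : R[i] -> R) (s : sign) (k z : R[i]).

(* The sign +-; the sign -+ is its opposite. *)
Definition sgnC s : R[i] := if s is Plus then 1 else - 1.

Definition e_ k z : R[i] := expi (2 * complex.Re (k * z)).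

Definition nu mu k z : R[i] := e_ (- k) z * (mu z)%:C.

Definition alpha mu k z : R[i] := - 'i * conjc k * e_ (- k) z * (mu z)%:C.

Definition opA s mu k (f : R[i] -> R[i]) z : R[i] :=
  - sgnC s * (conjc (alpha mu k z) * cauchyT f z +
              conjc (nu mu k z) * beurlingT f z).

(* neumann_u s mu k n is u_n for n >= 1. *)
Definition neumann_u s mu k (n : nat) : R[i] -> R[i] :=
  iter n.-1 (fun u z => - opA s mu k (conjc \o u) z)
    (fun z => - sgnC s * conjc (alpha mu k z)).

Definition neumann_omega s mu k (n : nat) z : R[i] :=
  - cauchyT (conjc \o neumann_u s mu k n) z.

End Neumann.

Section Tempered.
Context {R : realType}.

Definition schwartz_real (f : R -> R) : Prop :=
  (forall n x, derivable (derive1n n f) x 1) /\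
  (forall m n, exists M, forall x, `|x ^+ m * derive1n n f x| <= M).

Record schwartz := Schwartz {
  schwartz_fun :> R -> R[i] ;
  _ : schwartz_real (fun x => complex.Re (schwartz_fun x)) ;
  _ : schwartz_real (fun x => complex.Im (schwartz_fun x)) }.

Definition fourier (psi : R -> R[i]) (tau : R) : R[i] :=
  cintegral (@lebesgue_measure R) setT (fun t => expi (- (t * tau)) * psi t).

(* Fourier transform of the tempered distribution defined by f, as a functional
   on Schwartz functions: < F f, psi > = < f, F psi >. *)
Definition fourier_distr (f : R -> R[i]) : schwartz -> R[i] :=
  fun psi => cintegral (@lebesgue_measure R) setT
    (fun tau => f tau * fourier psi tau).

(* The distribution t |-> hat omega_n (z, t, e^{i phi}). *)
Definition omega_hat (s : sign) (mu : R[i] -> R) (n : nat)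
    (z : R[i]) (phi : R) : schwartz -> R[i] :=
  fourier_distr (fun tau => neumann_omega s mu (tau%:C * expi phi) n z).

End Tempered.

Arguments schwartz : clear implicits.

(* A formal series is the sequence of its terms, added and scaled termwise. *)
Definition formal_series (R : realType) := nat -> R[i] -> R -> schwartz R -> R[i].

HB.instance Definition _ (R : realType) := GRing.Lmodule.on (formal_series R).

Section FormalSeries.
Context {R : realType}.

(* Terms are indexed by n >= 1, so the term of index 0 is null. *)
Definition neumann_series (s : sign) (mu : R[i] -> R) : formal_series R :=
  fun n => if n is 0%N then 0 else omega_hat s mu n.

Definition odd_part (a : formal_series R) : formal_series R :=
  fun n => if odd n then a n else 0.

Definition even_part (a : formal_series R) : formal_series R :=
  fun n => if odd n then 0 else a n.

End FormalSeries.

(* Main.v *)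
(** The operators [cauchyT], [beurlingT] and the Fourier transform are odd and
    [opA] changes sign with [s], so [u_n] for [-mu] is [(-1)^n] times [u_n] for
    [mu]; the sign is carried through to [omega_n] and its transform. Oddness
    persists where an integral or a limit diverges, its junk value being [0]. *)
Require Import Defs.
From mathcomp Require Import all_boot all_order all_algebra.
From mathcomp Require Import all_classical all_reals all_analysis.
From mathcomp Require Import complex.
Import Order.TTheory GRing.Theory Num.Theory.
Import numFieldNormedType.Exports.
Local Open Scope classical_set_scope.
Local Open Scope ring_scope.
Local Open Scope complex_scope.

Section Oddness.
Context {R : realType}.
Implicit Types (mu : R[i] -> R) (f : R[i] -> R[i]).

(** A power of [-1] acts as the identity or as negation, so oddness of [T] suffices. Additivity
    cannot be relied on for integral operators applied to functions of unknown integrability. *)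
Lemma sign_scale_odd {K : pzRingType} {V W : lmodType K} {T : V -> W} n v :
  {morph T : u / - u} -> T ((-1) ^+ n *: v) = (-1) ^+ n *: T v.
Proof. by move=> TN; rewrite -signr_odd !scaler_sign; case: odd. Qed.

(** Negation exchanges the positive and negative parts, so their two integrals are subtracted in the
    opposite order. *)
Lemma RintegralN d (T : measurableType d) (m : {measure set T -> \bar R})
    (D : set T) (f : T -> R) :
  Rintegral m D (fun x => - f x) = - Rintegral m D f.
Proof.
rewrite /Rintegral; set F := fun x => (f x)%:E.
have -> : (fun x => (- f x)%:E) = (\- F)%E by [].
rewrite integralE (integralE _ _ F) funeposN funenegN.
(* When one of the two integrals is infinite, so is each difference, and [fine] sends both to [0].
   This covers [+oo - +oo], where oddness fails in the extended reals. *)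
case: (integral _ _ F^\-%E) (integral _ _ F^\+%E) => [a||] [b||] //=;
  by rewrite ?oppr0 ?opprB.
Qed.

Lemma cintegralN d (T : measurableType d) (m : {measure set T -> \bar R})
    (D : set T) (f : T -> R[i]) :
  cintegral m D (fun x => - f x) = - cintegral m D f.
Proof.
rewrite /cintegral; apply/eqP; rewrite eq_complex /=.
rewrite -!RintegralN; apply/andP; split; apply/eqP; congr (Rintegral _ _ _);
  by apply/funext => x; case: (f x).
Qed.

Lemma lim_opp (T : Type) (F : set_system T) (f : T -> R[i]) :
  ProperFilter F -> lim (- f x @[x --> F]) = - lim (f x @[x --> F]).
Proof.
move=> FF; have [cf|dvg] := pselect (cvg (f x @[x --> F])).
  exact: (@limN _ R[i]).
have dvgN : ~ cvg (- f x @[x --> F]).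
  by move=> cNf; apply: dvg; rewrite -(@is_cvgNE _ R[i] _ _ _ f).
(* The limit of a divergent filter is the default point, which in [R[i]] computes to [0], a fixed
   point of negation. *)
have -> : lim (f x @[x --> F]) = 0 := dvgP dvg.
have -> : lim (- f x @[x --> F]) = 0 := dvgP dvgN.
by rewrite oppr0.
Qed.

Lemma cintegral2N (D : set R[i]) f : cintegral2 D (- f) = - cintegral2 D f.
Proof. exact: cintegralN. Qed.

Lemma cauchyTN : {morph @cauchyT R : f / - f}.
Proof.
move=> f; apply/funext => z; rewrite /cauchyT [in RHS]opprfctE /=.
rewrite -mulrN -cintegral2N; congr (_ * cintegral2 _ _).
by apply/funext => w; rewrite /= mulNr.
Qed.

Lemma beurlingTN : {morph @beurlingT R : f / - f}.
Proof.
move=> f; apply/funext => z; rewrite /beurlingT [in RHS]opprfctE /=.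
rewrite -mulrN -lim_opp; congr (_ * _).
apply: (congr1 (fun g : R -> R[i] => lim (g e @[e --> 0^'+]))).
apply/funext => e; rewrite -cintegral2N; congr (cintegral2 _ _).
by apply/funext => w; rewrite /= mulNr.
Qed.

Lemma opAN s mu k : {morph opA s mu k : f / - f}.
Proof.
move=> f; apply/funext => z; rewrite /opA cauchyTN beurlingTN [in RHS]opprfctE /=.
by rewrite !fctE !mulrN -opprD mulrN.
Qed.

Lemma opA_Minus mu k f : opA Minus mu k f = - opA Plus mu k f.
Proof. by apply/funext => z; rewrite /opA [in RHS]opprfctE /= !mulNr. Qed.

Lemma conjc_compN : {morph (fun f => conjc \o f) : f / - f}.
Proof. by move=> f; apply/funext => z; rewrite /= !fctE /= rmorphN. Qed.

(** The initial term carries one sign, and each iteration adds one through [opA] while the earlier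
    ones pass through conjugation and [opA] by oddness. The index is [n.+1] since [neumann_u] at [0]
    is again the first term, which has the wrong parity there. *)
Lemma neumann_u_Minus mu k n :
  neumann_u Minus mu k n.+1 = (-1) ^+ n.+1 *: neumann_u Plus mu k n.+1.
Proof.
elim: n => [|n IHn].
  rewrite expr1 scaleN1r; apply/funext => z.
  by rewrite /neumann_u [in RHS]opprfctE /= !mulNr.
have uS s :
    neumann_u s mu k n.+2 = - opA s mu k (conjc \o neumann_u s mu k n.+1) by [].
rewrite !uS IHn opA_Minus (sign_scale_odd _ _ conjc_compN).
rewrite (sign_scale_odd _ _ (opAN _ _ _)).
by rewrite [in RHS]exprS -scalerA scaleN1r scalerN.
Qed.

Lemma neumann_omega_Minus mu k n :
  neumann_omega Minus mu k n.+1 = (-1) ^+ n.+1 *: neumann_omega Plus mu k n.+1.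
Proof.
have omegaE s :
    neumann_omega s mu k n.+1 = - cauchyT (conjc \o neumann_u s mu k n.+1) by [].
rewrite !omegaE neumann_u_Minus (sign_scale_odd _ _ conjc_compN).
by rewrite (sign_scale_odd _ _ cauchyTN) scalerN.
Qed.

Lemma fourier_distrN : {morph @fourier_distr R : f / - f}.
Proof.
move=> f; apply/funext => psi; rewrite /fourier_distr [in RHS]opprfctE -cintegralN.
by congr (cintegral _ _ _); apply/funext => t; rewrite /= mulNr.
Qed.

(** Index [0] is included because the series has a null term there. *)
Lemma neumann_series_Minus mu n :
  neumann_series Minus mu n = (-1) ^+ n *: neumann_series Plus mu n.
Proof.
case: n => [|n]; first by rewrite scaler0.
apply/funext => z; apply/funext => phi.
(* The scaling is evaluated at fixed [z] and [phi], where the term is a Fourier transform in [tau]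
   alone. *)
have -> : ((-1) ^+ n.+1 *: neumann_series Plus mu n.+1) z phi =
    (-1) ^+ n.+1 *: omega_hat Plus mu n.+1 z phi by [].
rewrite /omega_hat -(sign_scale_odd _ _ fourier_distrN).
rewrite /=; congr fourier_distr.
by apply/funext => tau; rewrite neumann_omega_Minus.
Qed.

(** At each index [b] is [a] or [- a], so in the half-sum and half-difference the terms of one
    parity cancel and those of the other double. *)
Lemma formal_series_parity (a b : formal_series R) :
  (forall n, b n = (-1) ^+ n *: a n) ->
  (odd_part a = - odd_part b /\ even_part a = even_part b) /\
  (odd_part a = 2^-1 *: (a - b) /\ even_part a = 2^-1 *: (a + b)).
Proof.
move=> bE.
have {}bE n : b n = if odd n then - a n else a n.
  by rewrite bE -signr_odd scaler_sign.
have half (v : R[i] -> R -> schwartz R -> R[i]) : 2^-1 *: (v + v) = v.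
  by rewrite scalerDr -scalerDl -[2^-1]div1r -splitr scale1r.
split; split; apply/funext => n.
- have -> : (- odd_part b) n = - odd_part b n by [].
  by rewrite /odd_part bE; case: (odd n); [rewrite opprK | rewrite oppr0].
- by rewrite /even_part bE; case: (odd n).
- have -> : (2^-1 *: (a - b)) n = 2^-1 *: (a n - b n) by [].
  rewrite /odd_part bE; case: (odd n); first by rewrite opprK half.
  by rewrite subrr scaler0.
- have -> : (2^-1 *: (a + b)) n = 2^-1 *: (a n + b n) by [].
  rewrite /even_part bE; case: (odd n); last by rewrite half.
  by rewrite subrr scaler0.
Qed.

End Oddness.

Theorem proposition8p1 (R : realType) (Omega Omega0 : set R[i]) (eps : R)
    (mu : R[i] -> R) :
  bounded_set Omega -> Omega !=set0 -> open Omega -> connected Omega ->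
  simply_connected Omega -> smooth_boundary (toC @^-1` Omega) ->
  precompact Omega0 -> closure Omega0 `<=` Omega ->
  0 < eps < 1 ->
  (mu \_ Omega) \o toC \in Lfun leb2 +oo%E ->
  ess_supp (mu \_ Omega) `<=` Omega0 ->
  (Lnorm leb2 +oo (EFin \o ((mu \_ Omega) \o toC)) <= (1 - eps)%:E)%E ->
  let wp := neumann_series Plus (mu \_ Omega) in
  let wm := neumann_series Minus (mu \_ Omega) in
  (odd_part wp = - odd_part wm /\ even_part wp = even_part wm) /\
  (odd_part wp = 2^-1 *: (wp - wm) /\ even_part wp = 2^-1 *: (wp + wm)).
Proof.
move=> *.
exact/formal_series_parity/neumann_series_Minus.
Qed.
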